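(* Let $A$ be a finite set and let $\varphi\colon A^\omega\to\mathbb{R}$ be a continuous payoff. Then $\varphi$ is positionally determined if and only if $\varphi$ is prefix-monotone.
   Context: $A^*$ and $A^\omega$ denote the sets of finite words and of infinite words over $A$. A payoff is a bounded function $\varphi\colon A^\omega\to\mathbb{R}$. Continuity is with respect to the product topology on $A^\omega$ of the discrete topology on $A$. Prefix-monotone: a payoff $\varphi$ is prefix-monotone if there are no $u,v\in A^*$ and $\beta,\gamma\in A^\omega$ such that $\varphi(u\beta)>\varphi(u\gamma)$ and $\varphi(v\beta)<\varphi(v\gamma)$. Games. An $A$-labeled game graph is a tuple $G=\langle V,V_{\mathrm{Max}},V_{\mathrm{Min}},E\rangle$ of finite sets such that $V$ is the disjoint union of $V_{\mathrm{Max}}$ and $V_{\mathrm{Min}}$, $E\subseteq V\times A\times V$, and for every $s\in V$ there exist $a\in A$, $t\in V$ with $(s,a,t)\in E$. For $e=(s,a,t)\in E$ put $\mathsf{source}(e)=s$, $\mathsf{lab}(e)=a$, $\mathsf{target}(e)=t$. A path is a non-empty finite or infinite sequence of edges in which the target of each edge is the source of the next one; moreover, for each $s\in V$ there is a $0$-length path $\lambda_s$ with $\mathsf{source}(\lambda_s)=\mathsf{target}(\lambda_s)=s$. The source of a path of positive length is the source of its first edge, and the target of a finite path of positive length is the target of its last edge. For a path $p$, $\mathsf{lab}(p)$ is the word of labels of its edges, in order. A strategy of Max is a mapping $\sigma$ assigning to every finite path $p$ (including $0$-length paths) with $\mathsf{target}(p)\in V_{\mathrm{Max}}$ an edge whose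 source is $\mathsf{target}(p)$; strategies of Min are defined analogously with $V_{\mathrm{Min}}$. An infinite path $\mathcal{P}$ is consistent with a strategy of Max $\sigma$ if for every finite prefix $p$ of $\mathcal{P}$ (including the $0$-length one) with $\mathsf{target}(p)\in V_{\mathrm{Max}}$, $\sigma(p)$ is the next edge of $\mathcal{P}$ after $p$; similarly for Min. $\mathsf{Cons}(s,\sigma)$ is the set of infinite paths starting at $s$ and consistent with $\sigma$. A strategy is positional if its value on a path $p$ depends only on $\mathsf{target}(p)$. The value at $s\in V$ of a strategy of Max $\sigma$ is $\mathbf{Val}[\sigma](s)=\inf\{\varphi(\mathsf{lab}(\mathcal P)) : \mathcal P\in\mathsf{Cons}(s,\sigma)\}$, and of a strategy of Min $\tau$ is $\mathbf{Val}[\tau](s)=\sup\{\varphi(\mathsf{lab}(\mathcal P)) : \mathcal P\in\mathsf{Cons}(s,\tau)\}$. A pair $(\sigma,\tau)$ of a strategy of Max and a strategy of Min is an equilibrium (w.r.t. $\varphi$) if $\mathbf{Val}[\sigma](s)=\mathbf{Val}[\tau](s)$ for every $s\in V$. The payoff $\varphi$ is positionally determined if every $A$-labeled game graph has an equilibrium (w.r.t. $\varphi$) consisting of two positional strategies. *)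

(* Defs.v *)
From HB Require Import structures.
From mathcomp Require Import all_boot all_order all_algebra.
From mathcomp Require Import all_classical all_reals all_analysis.
Import numFieldNormedType.Exports.

Set Implicit Arguments.
Unset Strict Implicit.
Unset Printing Implicit Defensive.

Import Order.TTheory GRing.Theory Num.Theory.
Local Open Scope ring_scope.

(* The type convertible to [nat -> A] carrying the product of the discrete
   topologies; [discrete_topology] makes this independent of any topology that
   [A] may already have as a canonical instance. *)
Definition infword (A : finType) := {ptws nat -> discrete_topology A}.

(* The letter at position [n] is the [n]-th letter of [u] when [n < size u] and
   otherwise the default value of [nth], which is letter [n - size u] of [b]. *)
Definition catw (A : finType) (u : seq A) (b : infword A) : infword A :=
  fun n => nth (b (n - size u)%N : A) u n.

Definition prefix_monotone (A : finType) (R : realType)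
    (phi : infword A -> R) : Prop :=
  ~ exists (u v : seq A) (b c : infword A),
      phi (catw u b) > phi (catw u c) /\ phi (catw v b) < phi (catw v c).

(* Vertex sets range over finite types, so the graph may be empty. *)
Record game_graph (A : finType) := GameGraph {
  vertex : finType;
  Vmax : {set vertex};
  Vmin : {set vertex};
  edges : {set vertex * A * vertex};
  VmaxU : Vmax :|: Vmin = [set: vertex]%SET;
  VmaxI : [disjoint Vmax & Vmin];
  edges_total : forall s : vertex, exists (a : A) (t : vertex),
    (s, a, t) \in edges
}.

Section Paths.
Variables (A : finType) (G : game_graph A).

Definition edge := {e : vertex G * A * vertex G | e \in edges G}.

Definition esource (e : edge) : vertex G := (val e).1.1.
Definition elab (e : edge) : A := (val e).1.2.
Definition etarget (e : edge) : vertex G := (val e).2.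

Fixpoint is_fpath (s : vertex G) (es : seq edge) : bool :=
  if es is e :: es' then (esource e == s) && is_fpath (etarget e) es' else true.

(* A finite path is recorded with its source: a path of positive length is
   determined by its edges, and the source distinguishes the empty paths. *)
Record fpath := FPath {
  fsource : vertex G;
  fedges : seq edge;
  fpathP : is_fpath fsource fedges
}.

Definition ftarget (p : fpath) : vertex G :=
  last (fsource p) [seq etarget e | e <- fedges p].

Record ipath := IPath {
  iedge :> nat -> edge;
  ipathP : forall n, etarget (iedge n) = esource (iedge n.+1)
}.

Definition isource (P : ipath) : vertex G := esource (P 0%N).

Definition ilab (P : ipath) : infword A := fun n => elab (P n).

Definition is_prefix (p : fpath) (P : ipath) : Prop :=
  fsource p = isource P /\ fedges p = mkseq P (size (fedges p)).

(* Strategies of the player controlling the vertices in [W]. *)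
Record strategy (W : {set vertex G}) := Strategy {
  strat :> forall p : fpath, ftarget p \in W -> edge;
  strat_source : forall (p : fpath) (hp : ftarget p \in W),
    esource (strat hp) = ftarget p
}.

Definition positional (W : {set vertex G}) (sigma : strategy W) : Prop :=
  forall (p q : fpath) (hp : ftarget p \in W) (hq : ftarget q \in W),
    ftarget p = ftarget q -> sigma p hp = sigma q hq.

Definition consistent (W : {set vertex G}) (sigma : strategy W) (P : ipath) :
    Prop :=
  forall (p : fpath) (hp : ftarget p \in W),
    is_prefix p P -> sigma p hp = P (size (fedges p)).

Definition consistent_paths (W : {set vertex G}) (s : vertex G)
    (sigma : strategy W) : set ipath :=
  [set P | isource P = s /\ consistent sigma P]%classic.

Variables (R : realType) (phi : infword A -> R).

(* [consistent_paths s sigma] is never empty, so for bounded [phi] these are a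
   genuine infimum and supremum in [R]. *)
Definition val_max (sigma : strategy (Vmax G)) (s : vertex G) : R :=
  inf [set phi (ilab P) | P in consistent_paths s sigma]%classic.

Definition val_min (tau : strategy (Vmin G)) (s : vertex G) : R :=
  sup [set phi (ilab P) | P in consistent_paths s tau]%classic.

Definition equilibrium (sigma : strategy (Vmax G)) (tau : strategy (Vmin G)) :
    Prop :=
  forall s : vertex G, val_max sigma s = val_min tau s.

End Paths.

Definition positionally_determined (A : finType) (R : realType)
    (phi : infword A -> R) : Prop :=
  forall G : game_graph A,
    exists (sigma : strategy (Vmax G)) (tau : strategy (Vmin G)),
      [/\ positional sigma, positional tau & equilibrium phi sigma tau].

(* Main.v *)
Require Import Defs.
From mathcomp Require Import all_boot all_order all_algebra.
From mathcomp Require Import all_classical all_reals all_analysis.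
From mathcomp Require Import zify.
Import numFieldNormedType.Exports.

(* Prefix-monotonicity says that the relation "phi (u b) <= phi (u c) for all u"
   is a total preorder on infinite words; it is closed by continuity and
   preserved by prepending letters. Compactness then gives a greatest assignment
   of words to vertices among those dominated by their one-step lookahead, and
   this assignment solves the Bellman equations. Playing positionally along its
   optimal edges is an equilibrium: on a consistent play with labels a1 a2 ...
   the word of the initial vertex stays on one side of a1 ... an followed by the
   word of the n-th vertex, and these words converge to the label of the play.
   Conversely, a violation of prefix-monotonicity persists after replacing the
   two words by lassos, which form a graph owned by Max where no single choice
   between the lassos is optimal after both prefixes. *)

Set Implicit Arguments.
Unset Strict Implicit.
Unset Printing Implicit Defensive.

Import Order.TTheory GRing.Theory Num.Theory.
Local Open Scope classical_set_scope.
Local Open Scope ring_scope.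

(** * Closed preorders on compact spaces, and the topology of infinite words *)

Lemma closed_fle (T : topologicalType) (R : realType) (f g : T -> R) :
  continuous f -> continuous g -> closed [set x | f x <= g x].
Proof.
move=> cf cg.
have -> : [set x | f x <= g x] = (fun x => g x - f x) @^-1` [set y | 0 <= y].
  by apply/seteqP; split => x /=; rewrite subr_ge0.
apply: preimage_closed; last exact: closed_ge.
by move=> x _; apply: cvgB; [exact: cg|exact: cf].
Qed.

(** Directedness makes the up-sets within [S] a filter base. By compactness it clusters at a point
    of [S], which lies in every up-set because these are closed. *)
Lemma compact_directed_top (T : topologicalType) (le : T -> T -> Prop)
    (S : set T) :
  (forall x, closed [set y | le x y]) ->
  (forall x y z, le x y -> le y z -> le x z) ->
  compact S -> S !=set0 ->
  (forall x y, S x -> S y -> exists2 z, S z & le x z /\ le y z) ->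
  exists2 z, S z & forall x, S x -> le x z.
Proof.
move=> cle tle cS S0 dirS.
pose B x := S `&` [set y | le x y].
have PF : ProperFilter (filter_from S B).
  apply: filter_from_proper; last first.
    by move=> x Sx; have [z Sz [xz _]] := dirS x x Sx Sx; exists z.
  apply: filter_from_filter => // x y Sx Sy.
  have [z Sz [xz yz]] := dirS x y Sx Sy; exists z => // t [St zt].
  by do 2 split => //=; apply: tle zt.
have [|z [Sz clz]] := cS _ PF.
  by have [x Sx] := S0; exists x => // y [].
exists z => // x Sx; apply: cle => C zC.
apply: clz => //; exists x => // y [] //.
Qed.

Lemma catwA (A : finType) (u v : seq A) (b : infword A) :
  catw u (catw v b) = catw (u ++ v) b.
Proof.
apply: funext => n; rewrite /catw size_cat subnDA.
rewrite nth_cat; case: ltnP => h; first exact: set_nth_default.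
by rewrite [LHS]nth_default.
Qed.

Lemma infword_cvgP (A : finType) (T : Type) (F : set_system T) (FF : Filter F)
    (f : T -> infword A) (b : infword A) :
  (f @ F --> b) <-> forall k, \forall x \near F, f x k = b k.
Proof.
split=> [+ k|fb].
  move/(pointwise_cvgP (V := discrete_topology A) b)/(_ k).
  by move/discrete_cvg.
apply/(pointwise_cvgP (V := discrete_topology A) b) => k.
by apply/discrete_cvg; apply: fb.
Qed.

Lemma continuous_catw (A : finType) (u : seq A) :
  continuous (catw u : infword A -> infword A).
Proof.
move=> b.
apply/(@infword_cvgP A (infword A) (nbhs b) _ (catw u) (catw u b)) => k.
rewrite /catw; have /(_ (k - size u)%N) :=
  (@infword_cvgP A (infword A) (nbhs b) (nbhs_filter b) id b).1 cvg_id.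
apply: filterS => c cb.
have [h|h] := ltnP k (size u); first exact: set_nth_default.
by rewrite !nth_default.
Qed.

Lemma compact_infword (A : finType) : compact [set: infword A].
Proof.
have -> : [set: infword A] =
    [set f : infword A | forall n, [set: discrete_topology A] (f n)].
  by apply/seteqP; split.
apply: (@tychonoff nat (fun=> discrete_topology A) (fun=> setT)) => _.
by apply: finite_compact; exact: (@finite_finset A).
Qed.

(** * The preorder on infinite words induced by the payoff *)

Section WordOrder.
Variables (A : finType) (R : realType) (phi : infword A -> R).
Hypothesis cphi : continuous phi.

Definition wle (b c : infword A) :=
  forall u : seq A, phi (catw u b) <= phi (catw u c).

Lemma wlexx b : wle b b. Proof. by move=> u. Qed.

Lemma wle_trans b c d : wle b c -> wle c d -> wle b d.
Proof. by move=> bc cd u; exact: le_trans (bc u) (cd u). Qed.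

(** Two words incomparable under [wle] yield one prefix violating each direction, which is exactly
    the forbidden configuration. *)
Lemma wle_total b c : prefix_monotone phi -> wle b c \/ wle c b.
Proof.
move=> mphi; apply: contrapT.
move=> /not_orP[/existsNP[u /negP bc] /existsNP[v /negP cb]].
by apply: mphi; exists u, v, b, c; rewrite !ltNge.
Qed.

Lemma wle_catw u b c : wle b c -> wle (catw u b) (catw u c).
Proof. by move=> bc v; rewrite !catwA. Qed.

Lemma wle_phi b c : wle b c -> phi b <= phi c.
Proof.
have E d : catw [::] d = d by apply: funext => n; rewrite /catw subn0 nth_nil.
by move=> /(_ [::]); rewrite !E.
Qed.

Lemma closed_wle (T : topologicalType) (f g : T -> infword A) :
  continuous f -> continuous g -> closed [set x | wle (f x) (g x)].
Proof.
move=> cf cg.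
have -> : [set x | wle (f x) (g x)] =
    \bigcap_(u in [set: seq A])
      [set x | phi (catw u (f x)) <= phi (catw u (g x))].
  by apply/seteqP; split => [x h u _|x h u]; [exact: h|exact: (h u)].
have cc u h : continuous h -> continuous (fun x : T => phi (catw u (h x))).
  move=> ch x; apply: (@continuous_comp T (infword A) R h (phi \o catw u)).
    exact: ch.
  apply: (@continuous_comp (infword A) (infword A) R (catw u) phi).
    exact: continuous_catw.
  exact: cphi.
by apply: closed_bigI => u _; apply: closed_fle; exact: cc.
Qed.

Lemma wle_bottom (b : infword A) :
  prefix_monotone phi -> exists c, forall d, wle c d.
Proof.
move=> mphi.
have [||||x y _ _|c _ cmin] := @compact_directed_top (infword A)
    (fun x y => wle y x) setT.
- move=> x; apply: (@closed_wle (infword A) id (fun=> x)); first by move=> y U.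
  exact: cst_continuous.
- by move=> x y z yx zy; exact: wle_trans zy yx.
- exact: compact_infword.
- by exists b.
- by case: (wle_total x y mphi) => xy; [exists x|exists y];
    rewrite //; split => //; exact: wlexx.
- by exists c => d; exact: cmin.
Qed.

End WordOrder.

(** * Bellman equations with words as values *)

Section Bellman.
Variables (A : finType) (R : realType) (phi : infword A -> R).
Hypotheses (cphi : continuous phi) (mphi : prefix_monotone phi).
Variable G : game_graph A.
Implicit Types (beta : vertex G -> infword A) (e : edge G) (s : vertex G).

Definition back beta e : infword A := catw [:: elab e] (beta (etarget e)).

(* [b] is below what the player at [s] can secure by moving once and then
   receiving the word [beta] of the vertex reached. *)
Definition secured beta s (b : infword A) :=
  (s \in Vmin G -> forall e, esource e = s -> wle phi b (back beta e)) /\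
  (s \in Vmax G -> exists2 e, esource e = s & wle phi b (back beta e)).

Lemma edge_from s : exists e, esource e = s.
Proof.
have [a [t st]] := edges_total s.
by exists (exist _ (s, a, t) st).
Qed.

Lemma VmaxNmin s : s \in Vmax G -> s \in Vmin G -> False.
Proof.
move=> sM sm; have /setP/(_ s) := disjoint_setI0 (VmaxI G).
by rewrite !inE sM sm.
Qed.

Lemma Vmax_or_min s : (s \in Vmax G) || (s \in Vmin G).
Proof. by rewrite -finset.in_setU VmaxU finset.in_setT. Qed.

Lemma back_mono beta beta' e : (forall s, wle phi (beta s) (beta' s)) ->
  wle phi (back beta e) (back beta' e).
Proof. by move=> bb; exact: wle_catw. Qed.

Lemma secured_mono beta beta' s b b' : wle phi b b' ->
  (forall s, wle phi (beta s) (beta' s)) ->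
  secured beta s b' -> secured beta' s b.
Proof.
move=> bb ll [m M]; split=> [sm e es|sM].
  exact: wle_trans bb (wle_trans (m sm e es) (back_mono e ll)).
have [e es be] := M sM; exists e => //.
exact: wle_trans bb (wle_trans be (back_mono e ll)).
Qed.

(** Max's existential condition is a union of closed sets over edges; it stays closed because there
    are finitely many edges. *)
Lemma closed_secured : closed
  [set beta : {ptws vertex G -> infword A} | forall s, secured beta s (beta s)].
Proof.
pose K s e := [set beta : {ptws vertex G -> infword A} |
  wle phi (beta s) (back beta e)].
have cK s e : closed (K s e).
  apply: (@closed_wle A R phi cphi {ptws vertex G -> infword A}
    (proj s) (fun beta => catw [:: elab e] (proj (etarget e) beta))).
    exact: (@proj_continuous (vertex G) (fun=> infword A)).
  move=> beta.
  apply: (@continuous_comp {ptws vertex G -> infword A} (infword A) (infword A)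
    (proj (etarget e)) (catw [:: elab e])).
    exact: (@proj_continuous (vertex G) (fun=> infword A)).
  exact: continuous_catw.
have -> : [set beta : {ptws vertex G -> infword A} |
    forall s, secured beta s (beta s)] =
    \bigcap_(s in [set: vertex G])
      ((\bigcap_(e in [set e | s \in Vmin G /\ esource e = s]) K s e) `&`
       (if s \in Vmax G then
          \bigcup_(e in [set e : edge G | esource e = s]) K s e else setT)).
  apply/seteqP; split => [beta h s _|beta h s].
    have [m M] := h s; split; first by move=> e [sm es]; exact: m.
    by case: ifP => // sM; have [e es ?] := M sM; exists e.
  have [m M] := h s I; split; first by move=> sm e es; exact: m.
  by move=> sM; move: M; rewrite sM => -[e es ?]; exists e.
apply: closed_bigI => s _; apply: closedI; first exact: closed_bigI.
case: ifP => _; last exact: closedT.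
by apply: closed_bigcup => //; exact: (@finite_finset (edge G)).
Qed.

(* A greatest assignment among those dominated by their one-step lookahead is a
   fixed point: raising a single component to its lookahead keeps it in the
   family. *)
Lemma bellman_fixpoint : exists beta, forall s,
  secured beta s (beta s) /\ forall b, secured beta s b -> wle phi b (beta s).
Proof.
pose T := {ptws vertex G -> infword A}.
pose S := [set beta : T | forall s, secured beta s (beta s)].
pose le (x y : T) := forall s, wle phi (x s) (y s).
have [||||x y Sx Sy|beta Sbeta top] := @compact_directed_top T le S.
- move=> x; have -> : [set y | le x y] =
      \bigcap_(s in [set: vertex G]) [set y : T | wle phi (x s) (y s)].
    by apply/seteqP; split => [y h s _|y h s]; [exact: h|exact: (h s)].
  apply: closed_bigI => s _.
  apply: (@closed_wle A R phi cphi T (fun=> x s) (proj s)).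
    exact: cst_continuous.
  exact: (@proj_continuous (vertex G) (fun=> infword A)).
- by move=> x y z xy yz s; exact: wle_trans (xy s) (yz s).
- apply: (@subclosed_compact _ _ [set: T]) => //; first exact: closed_secured.
  have -> : [set: T] = [set x : T | forall s, [set: infword A] (x s)].
    by apply/seteqP; split.
  apply: (@tychonoff (vertex G) (fun=> infword A) (fun=> setT)) => _.
  exact: compact_infword.
(* The constant least word is below any lookahead. If there are no words, there are no vertices
   either, since the label of an edge would give a constant word. *)
- have [[b]|noword] := pselect (exists b : infword A, True).
    have [c cmin] := wle_bottom cphi b mphi.
    exists (fun=> c) => s; split => [_ e _|_]; first exact: cmin.
    by have [e es] := edge_from s; exists e => //; exact: cmin.
  have void s : False.
    by have [e _] := edge_from s; apply: noword; exists (fun=> elab e).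
  by exists (fun s => False_rect _ (void s)) => s; case: (void s).
(* The pointwise maximum is an upper bound, and each of its components stays secured when the
   assignment grows. *)
- pose z s := if `[< wle phi (x s) (y s) >] then y s else x s.
  have xz : le x z.
    by move=> s; rewrite /z; case: asboolP => // _; exact: wlexx.
  have yz : le y z.
    move=> s; rewrite /z; case: asboolP => [_|]; first exact: wlexx.
    by case: (wle_total (x s) (y s) mphi).
  exists z => // s; rewrite {2}/z; case: asboolP => _.
    by apply: (secured_mono _ yz (Sy s)); exact: wlexx.
  by apply: (secured_mono _ xz (Sx s)); exact: wlexx.
- exists beta => s; split=> [|b sb]; first exact: Sbeta.
  have [//|sb'] := wle_total b (beta s) mphi.
  pose w : T := fun t => if t == s then b else beta t.
  have bw : le beta w.
    by move=> t; rewrite /w; case: eqP => [->|_] //; exact: wlexx.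
  have Sw : S w.
    move=> t; rewrite {2}/w; case: eqP => [->|_].
      by apply: (secured_mono _ bw sb); exact: wlexx.
    by apply: (secured_mono _ bw (Sbeta t)); exact: wlexx.
  by have := top w Sw s; rewrite /w eqxx.
Qed.

Lemma least_edge beta s : exists2 e, esource e = s &
  forall e', esource e' = s -> wle phi (back beta e) (back beta e').
Proof.
have [e0 /eqP e0s] := edge_from s.
pose ord (e e' : edge G) := `[< wle phi (back beta e) (back beta e') >].
have [|||e /eqP es emin] := @extremumP (edge G) (edge G) ord e0
    (fun e : edge G => esource e == s) id _ _ _ e0s.
- by move=> e; apply/asboolP; exact: wlexx.
- move=> e1 e2 e3 /asboolP e21 /asboolP e13; apply/asboolP.
  exact: wle_trans e21 e13.
- move=> e1 e2; apply/orP.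
  by have [h|h] := wle_total (back beta e1) (back beta e2) mphi; [left|right];
    apply/asboolP.
- by exists e => // e' /eqP e's; exact/asboolP/emin.
Qed.

(** At a Max vertex the edge is the witness in [secured]. At a Min vertex the least one-step
    lookahead is itself secured, so maximality puts it below [beta s]. *)
Lemma optimal_choice beta :
  (forall s, secured beta s (beta s) /\
    forall b, secured beta s b -> wle phi b (beta s)) ->
  exists f : vertex G -> edge G, forall s, [/\ esource (f s) = s,
    s \in Vmax G -> wle phi (beta s) (back beta (f s)) &
    s \in Vmin G -> wle phi (back beta (f s)) (beta s)].
Proof.
move=> bfix.
suff /choice[f fP] : forall s, exists e, [/\ esource e = s,
    s \in Vmax G -> wle phi (beta s) (back beta e) &
    s \in Vmin G -> wle phi (back beta e) (beta s)] by exists f.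
move=> s; have [[_ M] lub] := bfix s.
have [sM|sM] := boolP (s \in Vmax G).
  by have [e es be] := M sM; exists e; split => // /(VmaxNmin sM).
have [e es emin] := least_edge beta s.
exists e; split => // _; apply: lub; split => // sM'.
by rewrite sM' in sM.
Qed.

End Bellman.

(** * Positional strategies and their plays *)

Section Plays.
Variables (A : finType) (G : game_graph A).
Implicit Types (P : ipath G) (s : vertex G) (f : vertex G -> edge G).

Lemma is_fpath_mkseq (P : ipath G) m n :
  is_fpath (esource (P m)) [seq P i | i <- iota m n].
Proof.
elim: n m => //= n IHn m; rewrite eqxx /= ipathP.
exact: IHn.
Qed.

Lemma last_mkseq (P : ipath G) m n :
  last (esource (P m)) [seq etarget e | e <- [seq P i | i <- iota m n]] =
  esource (P (m + n)%N).
Proof.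
elim: n m => [|n IHn] m /=; first by rewrite addn0.
by rewrite ipathP IHn addnS.
Qed.

Lemma ftarget_prefix (p : Defs.fpath G) P :
  is_prefix p P -> ftarget p = esource (P (size (fedges p))).
Proof.
by move=> [ps pe]; rewrite /ftarget ps pe size_mkseq (last_mkseq P 0).
Qed.

Variable f : vertex G -> edge G.
Hypothesis fP : forall s, esource (f s) = s.

Definition positional_strategy (W : {set vertex G}) : strategy W :=
  @Strategy A G W (fun p _ => f (ftarget p)) (fun p _ => fP (ftarget p)).

Lemma positional_strategyP W : positional (positional_strategy W).
Proof. by move=> p q hp hq /= ->. Qed.

Lemma consistent_positional W P : consistent (positional_strategy W) P <->
  forall n, esource (P n) \in W -> P n = f (esource (P n)).
Proof.
split=> [cP n PnW|fPn p hp pP].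
  have tP : ftarget (FPath (is_fpath_mkseq P 0 n)) = esource (P n).
    exact: (last_mkseq P 0).
  have hp : ftarget (FPath (is_fpath_mkseq P 0 n)) \in W by rewrite tP.
  have pP : is_prefix (FPath (is_fpath_mkseq P 0 n)) P.
    by split=> //=; rewrite /mkseq size_map size_iota.
  by have := cP _ hp pP; rewrite /= size_map size_iota tP.
have tP := ftarget_prefix pP.
by rewrite /= tP; apply/esym/fPn; rewrite -tP.
Qed.

Lemma positional_play s : exists P, isource P = s /\
  forall n, P n = f (esource (P n)).
Proof.
pose P n := f (iter n (fun t => etarget (f t)) s).
have PP n : etarget (P n) = esource (P n.+1) by rewrite /P fP.
exists (IPath PP); rewrite /isource /= /P /= fP; split=> // n.
by rewrite fP.
Qed.

End Plays.

(** * Consistent plays as bounds on the values of strategies *)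

Section Values.
Variables (A : finType) (R : realType) (phi : infword A -> R).
Hypothesis phi_bounded : bounded_fun phi.
Variable G : game_graph A.

Lemma phi_bounds : exists M, forall b, - M <= phi b <= M.
Proof.
have [M [_ HM]] := phi_bounded.
(* Boundedness supplies a bound only for reals strictly above [M]. *)
exists (M + 1) => b; rewrite -ler_norml; apply: (HM (M + 1)) => //.
by rewrite ltrDl.
Qed.

Lemma val_max_le (sigma : strategy (Vmax G)) (P : ipath G) :
  consistent sigma P -> val_max phi sigma (isource P) <= phi (ilab P).
Proof.
move=> cP; have [M HM] := phi_bounds.
apply: ge_inf; last by exists P.
by exists (- M) => _ [Q _ <-]; case/andP: (HM (ilab Q)).
Qed.

Lemma val_min_ge (tau : strategy (Vmin G)) (P : ipath G) :
  consistent tau P -> phi (ilab P) <= val_min phi tau (isource P).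
Proof.
move=> cP; have [M HM] := phi_bounds.
apply: ub_le_sup; last by exists P.
by exists M => _ [Q _ <-]; case/andP: (HM (ilab Q)).
Qed.

End Values.

(** * Limits along a play, and sufficiency of prefix-monotonicity *)

Lemma catw_mkseqS (A : finType) (b c : infword A) n :
  catw (mkseq b n) (catw [:: b n] c) = catw (mkseq b n.+1) c.
Proof. by rewrite catwA mkseqS cats1. Qed.

(** The tails [g n] are arbitrary: letter [k] is settled once [n] exceeds [k]. *)
Lemma cvg_catw_mkseq (A : finType) (b : infword A) (g : nat -> infword A) :
  (fun n => catw (mkseq b n) (g n)) @ \oo --> b.
Proof.
apply/infword_cvgP => k; exists k.+1 => // n /= kn.
by rewrite /catw nth_mkseq.
Qed.

Section Sufficiency.
Variables (A : finType) (R : realType) (phi : infword A -> R).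
Hypothesis cphi : continuous phi.
Variable G : game_graph A.
Variable beta : vertex G -> infword A.

Lemma phi_cvg_catw (b : infword A) (g : nat -> infword A) :
  (fun n => phi (catw (mkseq b n) (g n))) @ \oo --> phi b.
Proof. exact: cvg_comp (@cvg_catw_mkseq A b g) (cphi (x := b)). Qed.

Lemma phi_play_ge (P : ipath G) :
  (forall n, wle phi (beta (esource (P n))) (back beta (P n))) ->
  phi (beta (isource P)) <= phi (ilab P).
Proof.
move=> bP; pose g n := beta (esource (P n)).
(* The induction carries [wle] rather than a comparison of payoffs, since each new inequality is
   used behind a prefix of labels. *)
have step n : wle phi (beta (isource P)) (catw (mkseq (ilab P) n) (g n)).
  elim: n => [|n IHn]; first by move=> u; rewrite catwA cats0.
  apply: wle_trans IHn _; rewrite -catw_mkseqS; apply: wle_catw.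
  by rewrite /g -ipathP; exact: bP.
apply: (cvgr_to_ge (@phi_cvg_catw (ilab P) g)).
by apply: nearW => n; exact/wle_phi/step.
Qed.

Lemma phi_play_le (P : ipath G) :
  (forall n, wle phi (back beta (P n)) (beta (esource (P n)))) ->
  phi (ilab P) <= phi (beta (isource P)).
Proof.
move=> bP; pose g n := beta (esource (P n)).
have step n : wle phi (catw (mkseq (ilab P) n) (g n)) (beta (isource P)).
  elim: n => [|n IHn]; first by move=> u; rewrite catwA cats0.
  apply: wle_trans IHn; rewrite -catw_mkseqS; apply: wle_catw.
  by rewrite /g -ipathP; exact: bP.
apply: (cvgr_to_le (@phi_cvg_catw (ilab P) g)).
by apply: nearW => n; exact/wle_phi/step.
Qed.

End Sufficiency.

Lemma prefix_monotone_determined (A : finType) (R : realType)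
    (phi : infword A -> R) :
  bounded_fun phi -> continuous phi ->
  prefix_monotone phi -> positionally_determined phi.
Proof.
move=> bphi cphi mphi G.
have [beta bfix] := bellman_fixpoint cphi mphi G.
have [f /all_and3[fP fM fm]] := optimal_choice mphi bfix.
pose sigma := positional_strategy fP (Vmax G).
pose tau := positional_strategy fP (Vmin G).
exists sigma, tau; split; [exact: positional_strategyP..|move=> s].
have ge P : consistent sigma P -> phi (beta (isource P)) <= phi (ilab P).
  move/consistent_positional => cP; apply: (phi_play_ge cphi) => // n.
  have [sM|] := boolP (esource (P n) \in Vmax G).
    by rewrite {2}cP //; exact: fM.
  (* At a Min vertex [secured] bounds the lookahead along every edge. *)
  have /orP[-> //|sm _] := Vmax_or_min (esource (P n)).
  by have [[m _] _] := bfix (esource (P n)); exact: m.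
have le P : consistent tau P -> phi (ilab P) <= phi (beta (isource P)).
  move/consistent_positional => cP; apply: (phi_play_le cphi) => // n.
  have [sm|] := boolP (esource (P n) \in Vmin G).
    by rewrite {1}cP //; exact: fm.
  have /orP[sM _|-> //] := Vmax_or_min (esource (P n)).
  (* At a Max vertex the lookahead along any edge is secured by that edge. *)
  have [_ lub] := bfix (esource (P n)); apply: lub.
  split=> [/(VmaxNmin sM)//|_].
  by exists (P n) => //; exact: wlexx.
(* The play along [f] is consistent with both strategies. It gives one inequality between the values
   and makes both sets of payoffs nonempty for the other. *)
have [P [Ps PfP]] := positional_play fP s.
have cs : consistent sigma P by apply/consistent_positional => n _; exact: PfP.
have ct : consistent tau P by apply/consistent_positional => n _; exact: PfP.
apply/eqP; rewrite eq_le; apply/andP; split.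
  by rewrite -Ps; apply: le_trans (val_max_le bphi cs) (val_min_ge bphi ct).
apply: (@le_trans _ _ (phi (beta s))).
  apply: ge_sup; first by exists (phi (ilab P)), P.
  by move=> _ [Q [Qs cQ] <-]; rewrite -Qs; exact: le.
apply: lb_le_inf; first by exists (phi (ilab P)), P.
by move=> _ [Q [Qs cQ] <-]; rewrite -Qs; exact: ge.
Qed.

(** * One-player graphs with a single binary choice *)

Section TwoModes.
Variables (A : finType) (V : finType).
Variables (lb : bool -> V -> A) (nx : bool -> V -> V).

(* Each vertex has one outgoing edge per mode; where the modes disagree at a
   single vertex, a positional strategy amounts to fixing a mode. *)
Definition mode_edges : {set V * A * V} :=
  [set e | [exists d, e == (e.1.1, lb d e.1.1, nx d e.1.1)]]%SET.

Lemma mode_edgesP d s : (s, lb d s, nx d s) \in mode_edges.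
Proof. by rewrite inE; apply/existsP; exists d. Qed.

Lemma mode_edges_total s : exists (a : A) (t : V), (s, a, t) \in mode_edges.
Proof. by exists (lb true s), (nx true s); exact: mode_edgesP. Qed.

Lemma mode_VU : [set: V]%SET :|: finset.set0 = [set: V]%SET.
Proof. by rewrite finset.setU0. Qed.

Lemma mode_VI :
  fintype.disjoint (mem [set: V]%SET) (mem (finset.set0 : {set V})).
Proof. by rewrite -finset.setI_eq0 finset.setI0. Qed.

Definition mode_graph : game_graph A :=
  @GameGraph A V finset.setT finset.set0 mode_edges mode_VU mode_VI
    mode_edges_total.

Definition mode_word d s : infword A := fun n => lb d (iter n (nx d) s).

Lemma mode_wordS d s :
  mode_word d s = catw [:: lb d s] (mode_word d (nx d s)).
Proof.
apply: funext => -[|n] //.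
by rewrite /mode_word /catw iterSr /= nth_default // subSS subn0.
Qed.

Definition mode_edge d s : edge mode_graph :=
  exist (fun e => e \in edges mode_graph) (s, lb d s, nx d s) (mode_edgesP d s).

Lemma edge_modeP (e : edge mode_graph) : exists d, e = mode_edge d (esource e).
Proof.
have := valP e; rewrite inE => /existsP[d /eqP ed].
by exists d; apply: val_inj.
Qed.

Definition mode_play d s : ipath mode_graph :=
  @IPath A mode_graph (fun n => mode_edge d (iter n (nx d) s)) (fun=> erefl).

(** Min owns no vertex, so every play is consistent with [tau] and pays at most the common value.
    The play in the mode that [sigma] picks at [w] is consistent with [sigma] and pays at least that
    value, from every start. *)
Lemma mode_choice (R : realType) (phi : infword A -> R) (w : V) :
  bounded_fun phi -> positionally_determined phi ->
  (forall s, s != w -> lb true s = lb false s /\ nx true s = nx false s) ->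
  exists d, forall s, phi (mode_word (~~ d) s) <= phi (mode_word d s).
Proof.
move=> bphi /(_ mode_graph)[sigma [tau [psigma _ eq_val]]] agree.
pose p0 := @FPath A mode_graph w [::] isT.
have p0M : ftarget p0 \in Vmax mode_graph by rewrite finset.in_setT.
have [d sp0] := edge_modeP (sigma p0 p0M).
rewrite strat_source /= in sp0.
exists d => s.
have ct : consistent tau (mode_play (~~ d) s).
  by move=> p hp; have := hp; rewrite finset.in_set0.
have cs : consistent sigma (mode_play d s).
  move=> p hp /ftarget_prefix tp.
  change (sigma p hp =
    mode_edge d (esource (mode_play d s (size (fedges p))))).
  rewrite -tp; have [pw|pw] := eqVneq (ftarget p) w.
    by rewrite (psigma p p0 hp p0M pw) sp0 pw.
  have [d'] := edge_modeP (sigma p hp); rewrite strat_source => ->.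
  apply: val_inj => /=; have [lbE nxE] := agree _ pw.
  by case: (d); case: (d'); rewrite ?lbE ?nxE.
apply: le_trans (val_max_le bphi cs).
by rewrite eq_val; exact: (val_min_ge bphi ct).
Qed.

End TwoModes.

(** * Two lassos reached through two prefixes *)

Section TwoLassos.
Variables (A : finType) (n : nat) (u : bool -> seq A) (b : bool -> infword A).

(* [None] is the vertex where the two lassos part; [Some (false, c, i)] is the
   vertex from which it is reached by reading the last [i.+1] letters of [u c],
   and [Some (true, d, i)] emits letter [minn i.+1 n] of the word [b d], so
   that the last vertex loops on letter [n]. *)
Let bound := maxn n (maxn (size (u true)) (size (u false))).
Let V : finType := option (bool * bool * 'I_bound.+1).

Definition chain (c : bool) (k : nat) : V :=
  if k is k'.+1 then Some (false, c, inord k') else None.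

Definition lasso_label (d : bool) (s : V) : A :=
  match s with
  | None => b d 0%N
  | Some (false, c, i) => nth (b c 0%N) (u c) (size (u c) - i.+1)
  | Some (true, c, i) => b c (minn i.+1 n)
  end.

Definition lasso_next (d : bool) (s : V) : V :=
  match s with
  | None => Some (true, d, ord0)
  | Some (false, c, i) => chain c i
  | Some (true, c, i) => Some (true, c, inord (minn i.+1 n))
  end.

Local Notation word := (mode_word lasso_label lasso_next).

Lemma lasso_word_loop d : word d None = (fun k => b d (minn k n)).
Proof.
apply: funext => -[|k]; first by rewrite /mode_word /= min0n.
rewrite /mode_word iterSr /=.
have -> : iter k (lasso_next d) (Some (true, d, ord0)) =
    Some (true, d, inord (minn k n)).
  elim: k => [|k IHk] /=.
    by rewrite min0n; congr (Some (_, _)); apply: val_inj; rewrite /= inordK.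
  rewrite IHk /= inordK; last by rewrite ltnS /bound; lia.
  by congr (Some (_, _, inord _)); lia.
rewrite /= inordK; last by rewrite ltnS /bound; lia.
by congr (b d _); lia.
Qed.

Lemma lasso_word_chain d c k : (k <= size (u c))%N ->
  word d (chain c k) = catw (drop (size (u c) - k) (u c)) (word d None).
Proof.
elim: k => [_|k IHk ku].
  by rewrite subn0 drop_size; apply: funext => k; rewrite /catw subn0 nth_nil.
(* [inord] keeps the index intact only up to [bound], which dominates both prefix lengths. *)
have kV : (k < bound.+1)%N.
  by rewrite /bound; move: ku; case: c {IHk}; lia.
rewrite mode_wordS /= inordK // IHk ?(ltnW ku) // catwA.
have uk : (size (u c) - k.+1 < size (u c))%N by move: ku; clear; lia.
rewrite (drop_nth (b c 0%N) uk) /=.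
by have -> : (size (u c) - k.+1).+1 = (size (u c) - k)%N by lia.
Qed.

Lemma lasso_choice (R : realType) (phi : infword A -> R) :
  bounded_fun phi -> positionally_determined phi ->
  exists d, forall c,
    phi (catw (u c) (fun k => b (~~ d) (minn k n))) <=
    phi (catw (u c) (fun k => b d (minn k n))).
Proof.
move=> bphi pphi.
have [|d hd] := @mode_choice A V lasso_label lasso_next R phi None bphi pphi.
  by case=> [[[[] c] i]|].
exists d => c; have := hd (chain c (size (u c))).
by rewrite !lasso_word_chain // subnn drop0 !lasso_word_loop.
Qed.

End TwoLassos.

(** * Necessity of prefix-monotonicity *)

Lemma determined_prefix_monotone (A : finType) (R : realType)
    (phi : infword A -> R) :
  bounded_fun phi -> continuous phi ->
  positionally_determined phi -> prefix_monotone phi.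
Proof.
move=> bphi cphi pphi [u [v [b [c [ub vb]]]]].
(* Repeating letter [n] forever turns [x] into a lasso word that agrees with it up to that
   letter. *)
pose trunc (x : infword A) n : infword A := fun k => x (minn k n).
have cvg_trunc w x : phi (catw w (trunc x n)) @[n --> \oo] --> phi (catw w x).
  have tx : trunc x @ \oo --> x.
    apply/infword_cvgP => k; exists k => // n /= kn.
    by rewrite /trunc (minn_idPl kn).
  have h : (fun n => catw w (trunc x n)) @ \oo --> catw w x.
    by apply: cvg_comp tx _; exact: continuous_catw.
  by apply: cvg_comp h _; exact: cphi.
have eventually_lt w x y : phi (catw w x) < phi (catw w y) ->
    exists N, forall n, (N <= n)%N ->
      phi (catw w (trunc x n)) < phi (catw w (trunc y n)).
  rewrite -subr_gt0 => xy.
  have [N _ HN] := cvgr_gt _ (cvgB (cvg_trunc w y) (cvg_trunc w x)) 0 xy.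
  by exists N => n /HN /=; rewrite subr_gt0.
have [N ltu] := eventually_lt _ _ _ ub; have [M ltv] := eventually_lt _ _ _ vb.
pose n := maxn N M.
have ubn := ltu n (leq_maxl _ _); have vbn := ltv n (leq_maxr _ _).
have [d hd] := @lasso_choice A n (fun c => if c then u else v)
  (fun d => if d then b else c) R phi bphi pphi.
(* Mode [true] always continues with [b], which is worse after [v]; mode [false] continues with [c],
   which is worse after [u]. *)
case: d hd => hd; first by have := hd false; rewrite leNgt vbn.
by have := hd true; rewrite leNgt ubn.
Qed.

Theorem theorem3p2 (A : finType) (R : realType) (phi : infword A -> R)
    (phi_bounded : bounded_fun phi) (phi_continuous : continuous phi) :
  positionally_determined phi <-> prefix_monotone phi.
Proof.
split; first exact: determined_prefix_monotone.
exact: prefix_monotone_determined.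
Qed.
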